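(* For every integer $m \ge 2$, the minimal orders $p$ and $q$ of an $m$-variate ARMA model are not individually invariants of the system that the model represents. That is, there exists an $m$-output linear system with transfer function $H(z)$ that admits two different minimal order pairs $(p,q) \neq (p',q')$.
   Context: An ARMA$(p,q)$ model for an $m$-component vector time series $\{y_t\}$ is an equation $A_0 y_t + A_1 y_{t-1} + \dots + A_p y_{t-p} = B_0 \varepsilon_t + B_1 \varepsilon_{t-1} + \dots + B_q \varepsilon_{t-q}$, where the $A_i, B_i$ are real $m\times m$ matrices and $\{\varepsilon_t\}$ is an $m$-dimensional zero-mean Gaussian white noise. Put $A(z) = A_0 + A_1 z^{-1} + \dots + A_p z^{-p}$ and $B(z) = B_0 + B_1 z^{-1} + \dots + B_q z^{-q}$, with $A(z)$ invertible as a rational matrix. The transfer function of the model is $H(z) = A(z)^{-1}B(z)$, assumed to have an expansion $H(z)=\sum_{i\ge 0} H_i z^{-i}$. A system is identified with its transfer function $H(z)$ (equivalently, with the sequence $\{H_i\}$), and a model represents the system if $A(z)^{-1}B(z) = H(z)$. A pair $(p,q)$ of nonnegative integers is called a minimal order pair of the system $H(z)$ if $H(z)$ is represented by some ARMA$(p,q)$ model and by no ARMA$(p_1,q_1)$ model with $p_1 \le p$, $q_1 \le q$ and $(p_1,q_1)\neq(p,q)$. *)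

(* Defs.v *)
From mathcomp Require Import all_boot all_order all_algebra.
From mathcomp Require Import reals.

Set Implicit Arguments.
Unset Strict Implicit.
Unset Printing Implicit Defensive.

Import GRing.Theory.
Local Open Scope ring_scope.

Notation ratfun R := {fraction {poly R}}.
Local Notation "x %:F" := (@FracField.tofrac _ x).

Section Arma.
Variable R : realType.

(* Rational functions are in the indeterminate z; a model is written in powers
   of z^-1. *)
Definition zvar : ratfun R := ('X : {poly R})%:F.

Definition ratconst (c : R) : ratfun R := (c%:P)%:F.

(* Bounded at z = oo; n and d need not be coprime. *)
Definition proper (f : ratfun R) : Prop :=
  exists n d : {poly R},
    [/\ d != 0, (size n <= size d)%N & f = n%:F / d%:F].

Definition polyzinv (m n : nat) (C : 'I_n.+1 -> 'M[R]_m) : 'M[ratfun R]_m :=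
  \sum_(i < n.+1) zvar ^- i *: map_mx ratconst (C i).

(* Expansion at infinity: the remainder after the terms of index < N is
   O(z^-N), that is, z^N times it is proper. *)
Definition has_expansion (m : nat) (H : 'M[ratfun R]_m)
    (h : nat -> 'M[R]_m) : Prop :=
  forall (N : nat) (i j : 'I_m),
    proper (zvar ^+ N *
      (H - \sum_(k < N) zvar ^- k *: map_mx ratconst (h k)) i j).

(* Neither the end coefficients nor A_0 are constrained: only A(z) has to be
   invertible over the field of rational functions.  The noise is left out, as
   a model enters only through its transfer function. *)
Record arma (m p q : nat) := Arma {
  ar_coef : 'I_p.+1 -> 'M[R]_m;
  ma_coef : 'I_q.+1 -> 'M[R]_m;
  ar_unit : polyzinv ar_coef \in unitmx
}.

Definition transfer (m p q : nat) (M : arma m p q) : 'M[ratfun R]_m :=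
  invmx (polyzinv (ar_coef M)) *m polyzinv (ma_coef M).

Definition representable (m : nat) (H : 'M[ratfun R]_m) (p q : nat) : Prop :=
  exists M : arma m p q, transfer M = H.

Definition minimal_order_pair (m : nat) (H : 'M[ratfun R]_m)
    (pq : nat * nat) : Prop :=
  representable H pq.1 pq.2 /\
  forall p1 q1 : nat, (p1 <= pq.1)%N -> (q1 <= pq.2)%N -> (p1, q1) <> pq ->
    ~ representable H p1 q1.

End Arma.

(* Main.v *)
Require Import Defs.
From mathcomp Require Import all_boot all_order all_algebra.
From mathcomp Require Import reals.
From HB Require Import structures.

(** The orders can be traded against each other because a nonconstant matrix
    polynomial in [z^-1] may have an inverse that is again a polynomial in
    [z^-1].  Take a real matrix [N <> 0] with [N *m N = 0], which exists as soon
    as [m >= 2], and let [H = 1 + z^-1 N].  Then [H] is its own moving average of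
    order 1, so (0, 1) represents it ([affine_system_ma]); and
    [(1 - z^-1 N) H = 1], so the pure autoregression (1, 0) represents it too
    ([affine_system_ar]).  Below either pair there is only (0, 0), whose transfer
    functions are constant matrices, whereas [H] depends on [z]
    ([affine_system_not_constant]).  Hence both pairs are minimal. *)

Import GRing.Theory.
Local Open Scope ring_scope.

Section AffineSystem.
Set Implicit Arguments.
Unset Strict Implicit.

Variable R : realType.

Local Notation zvar := (zvar R).
Local Notation ratconst := (@ratconst R).

(** Matrix identities over [R] carry over to rational matrices through the
    [map_mx] lemmas on ring morphisms. *)
HB.instance Definition _ := GRing.RMorphism.copy ratconst
  (@FracField.tofrac {poly R} \o polyC).

Lemma zvar_neq0 : zvar != 0.
Proof. by rewrite tofrac_eq0 polyX_eq0. Qed.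

(** Otherwise [c * z = 1] would hold for polynomials, and fails at [z = 0]. *)
Lemma zvarV_not_const (c : R) : zvar^-1 <> ratconst c.
Proof.
move=> zVc; have /eqP : ratconst c * zvar = 1 by rewrite -zVc mulVf ?zvar_neq0.
rewrite -tofracM -tofrac1 tofrac_eq => /eqP/(congr1 (horner^~ 0)).
by rewrite hornerM hornerX mulr0 hornerC => /esym/eqP; rewrite oner_eq0.
Qed.

Lemma proper_affine (a b : R) : Defs.proper (ratconst a + zvar^-1 * ratconst b).
Proof.
exists (a *: 'X + b%:P), 'X; split; first by rewrite polyX_eq0.
  rewrite (leq_trans (size_polyD _ _)) // geq_max.
  rewrite (leq_trans (size_scale_leq _ _)) //= size_polyX size_polyC.
  by case: (b != 0).
rewrite -mul_polyC tofracD tofracM mulrDl mulfK ?zvar_neq0 //.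
by rewrite (mulrC zvar^-1).
Qed.

Variable m : nat.
Implicit Types N C D : 'M[R]_m.

Definition affine_system N : 'M[ratfun R]_m :=
  1%:M + zvar^-1 *: map_mx ratconst N.

Definition affine_coef C D : 'I_2 -> 'M[R]_m := fun i => if i == 0 then C else D.

Lemma polyzinv_const (C : 'I_1 -> 'M[R]_m) :
  polyzinv C = map_mx ratconst (C 0).
Proof. by rewrite /polyzinv big_ord1 expr0 invr1 scale1r. Qed.

Lemma polyzinv_affine C D :
  polyzinv (affine_coef C D) = map_mx ratconst C + zvar^-1 *: map_mx ratconst D.
Proof. by rewrite /polyzinv big_ord_recl big_ord1 expr0 invr1 scale1r. Qed.

Lemma affine_system_expansion N :
  has_expansion (affine_system N)
    (fun k => match k with 0 => 1%:M | 1 => N | _ => 0 end).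
Proof.
(* The remainders of index 0, 1 and at least 2 are [1 + z^-1 N], [z^-1 N] and 0;
   each, times its power of z, is affine in z^-1. *)
move=> [|[|n]] i j.
- rewrite big_ord0 subr0 expr0 mul1r /affine_system -(map_mx1 ratconst) !mxE.
  exact: proper_affine.
- rewrite big_ord1 expr0 invr1 scale1r map_mx1 /affine_system addrC addKr.
  rewrite !mxE mulVKf ?zvar_neq0 //.
  by have := proper_affine (N i j) 0; rewrite rmorph0 mulr0 addr0.
- rewrite !big_ord_recl big1 => [|k _]; last by rewrite /= map_mx0 scaler0.
  rewrite /= expr0 invr1 scale1r map_mx1 addr0 expr1 subrr mxE mulr0.
  by have := proper_affine 0 0; rewrite rmorph0 mulr0 addr0.
Qed.

Lemma affine_system_ma N : representable (affine_system N) 0 1.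
Proof.
have A_unit : polyzinv (fun _ : 'I_1 => 1%:M : 'M[R]_m) \in unitmx.
  by rewrite polyzinv_const map_mx1 unitmx1.
exists (Arma (affine_coef 1%:M N) A_unit).
by rewrite /transfer /= polyzinv_const polyzinv_affine map_mx1 invmx1 mul1mx.
Qed.

(** Since [N *m N = 0], the geometric series for the inverse of [1 - z^-1 N]
    stops after its linear term. *)
Lemma affine_system_ar N : N *m N = 0 -> representable (affine_system N) 1 0.
Proof.
move=> NN0.
have AH1 : polyzinv (affine_coef 1%:M (- N)) *m affine_system N = 1%:M.
  rewrite polyzinv_affine map_mx1 map_mxN scalerN mulmxBl mul1mx mulmxDr mulmx1.
  by rewrite -scalemxAl -scalemxAr -map_mxM NN0 map_mx0 !scaler0 addr0 addrK.
have [A_unit _] := mulmx1_unit AH1.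
exists (Arma (fun _ : 'I_1 => 1%:M) A_unit).
by rewrite /transfer /= polyzinv_const map_mx1 -AH1 mulKmx.
Qed.

(** At a nonzero entry of [N], [z^-1] can be solved for from the system by real
    constants alone, so a constant system would make [z^-1] constant. *)
Lemma affine_system_not_constant N :
  N != 0 -> ~ representable (affine_system N) 0 0.
Proof.
move=> N_neq0 [[A B A_unit]]; rewrite /transfer /= !polyzinv_const.
rewrite -map_invmx -map_mxM; move: (_ *m _) => C H_const.
have /matrix0Pn[i [j Nij]] := N_neq0.
apply: (zvarV_not_const (c := (C i j - (1%:M : 'M[R]_m) i j) / N i j)).
have Nij' : ratconst (N i j) != 0 by rewrite fmorph_eq0.
have /(congr1 (fun M : 'M_m => M i j)) := H_const.
rewrite /affine_system -(map_mx1 ratconst) !mxE => Cij.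
by rewrite fmorph_div rmorphB /= Cij [ratconst _ + _]addrC addrK mulfK.
Qed.

End AffineSystem.

Theorem theorem1 (R : realType) (m : nat) (hm : (2 <= m)%N) :
  exists H : 'M[ratfun R]_m,
    (exists h : nat -> 'M[R]_m, has_expansion H h) /\
    exists pq pq' : nat * nat,
      [/\ pq <> pq', minimal_order_pair H pq & minimal_order_pair H pq'].
Proof.
pose i0 := Ordinal (ltnW hm); pose i1 := Ordinal hm.
pose N : 'M[R]_m := delta_mx i0 i1.
have NN0 : N *m N = 0 by rewrite mul_delta_mx_0.
have N_neq0 : N != 0.
  apply/eqP => /matrixP/(_ i0 i1)/eqP.
  by rewrite !mxE !eqxx oner_eq0.
have not00 := affine_system_not_constant N_neq0.
exists (affine_system N); split; first by eexists; exact: affine_system_expansion.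
exists (0, 1)%N, (1, 0)%N; split=> //.
- split; first exact: affine_system_ma.
  by move=> [|p] [|[|q]].
- split; first exact: affine_system_ar.
  by move=> [|[|p]] [|q].
Qed.
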